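(* Let $n\ge2$, $\delta\ge0$, and let $C:\mathbb R^n_{+,0}\setminus\{0\}\to\mathbb R_+$ be twice continuously differentiable with Hessian matrix $H(\xi)$. Let $B$ be an $n\times(n-1)$ matrix whose columns form an orthonormal basis of the subspace of $\mathbb R^n$ orthogonal to $[1,\dots,1]^T$, let $\hat H(\xi)=B^TH(\xi)B$ be the projected Hessian, and let $\Lambda(\hat H(\xi))$ be the maximum eigenvalue of $\hat H(\xi)$. If $$\min_{1\le i\le n}C(e_i)>\delta+\max\Big\{0,\ \max_{\xi\in\Xi_n}\Lambda\big(\hat H(\xi)\big)\Big\},$$ then the mode with cost $C$ is absolutely $\delta$-causal.
   Context: $\Xi_n=\{\xi\in\mathbb R^n:\xi_1+\dots+\xi_n=1,\ \xi_j\ge0\ \forall j\}$; $\mathbb R_+=(0,\infty)$; $\mathbb R^n_{+,0}=\{W\in\mathbb R^n:W_j\ge0\ \forall j\}$; $e_1,\dots,e_n$ is the standard basis of $\mathbb R^n$. Twice continuously differentiable on $\mathbb R^n_{+,0}\setminus\{0\}$ means that $C$ is the restriction of a $C^2$ function defined on an open neighborhood of this set. A mode with $n$ successor nodes is described by its transition-cost function $C$ restricted to $\Xi_n$. For $W\in\mathbb R^n_{+,0}$, $V(W)=\min_{\xi\in\Xi_n}\{C(\xi)+\xi^TW\}$ and $\Xi^*(W)$ is the set of minimizers. The mode is absolutely $\delta$-causal if for all $W\in\mathbb R^n_{+,0}$, all $\xi^*\in\Xi^*(W)$ and all $j\in\{1,\dots,n\}$: $\xi^*_j>0$ implies $V(W)>W_j+\delta$.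 *)

(* Defs.v *)
From HB Require Import structures.
From mathcomp Require Import all_boot all_order all_algebra.
From mathcomp Require Import all_classical all_reals all_analysis.

Set Implicit Arguments.
Unset Strict Implicit.
Unset Printing Implicit Defensive.

Import Order.TTheory GRing.Theory Num.Theory.
Import numFieldNormedType.Exports.

Local Open Scope classical_set_scope.
Local Open Scope ring_scope.

(* Points of R^n are row vectors, the convention of the differential calculus
   of the library. *)

Section Extrema.
Context {R : realType}.
Implicit Type A : set R.

(* The greatest (least) element of A; 0 if A has none. *)
Definition setmax A : R := xget 0 [set m | A m /\ ubound A m].
Definition setmin A : R := xget 0 [set m | A m /\ lbound A m].

Definition max_eigenvalue m (M : 'M[R]_m) : R :=
  setmax [set a | eigenvalue M a].

End Extrema.

Section Smoothness.
Context {R : realType} {n : nat}.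
Implicit Types (D U : set 'rV[R]_n) (F C : 'rV[R]_n -> R).

Definition basis_vec (i : 'I_n) : 'rV[R]_n := delta_mx 0 i.

Definition partial (i : 'I_n) F : 'rV[R]_n -> R :=
  fun x => 'D_(basis_vec i) F x.

Definition hessian F (x : 'rV[R]_n) : 'M[R]_n :=
  \matrix_(i, j) partial i (partial j F) x.

Definition C0_on U F := forall x, U x -> {for x, continuous F}.

Definition C1_on U F :=
  C0_on U F /\
  forall i, (forall x, U x -> derivable F x (basis_vec i)) /\
            C0_on U (partial i F).

Definition C2_on U F := C1_on U F /\ forall i, C1_on U (partial i F).

(* C, which matters only on D, is the restriction to D of a C^2 function F on
   an open neighborhood of D, and H is the Hessian of F on D. When D is in the
   closure of its interior, as the punctured orthant below, H is determined on
   D by C alone. *)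
Definition C2_with_hessian D C (H : 'rV[R]_n -> 'M[R]_n) :=
  exists U F, [/\ open U, D `<=` U, C2_on U F &
    forall x, D x -> C x = F x /\ H x = hessian F x].

End Smoothness.

Section Causality.
Context {R : realType} {n : nat}.
Implicit Types (C : 'rV[R]_n -> R) (W xi : 'rV[R]_n).

Definition orthant : set 'rV[R]_n := [set W | forall j, 0 <= W 0 j].

Definition simplex : set 'rV[R]_n :=
  [set xi | \sum_j xi 0 j = 1 /\ forall j, 0 <= xi 0 j].

Definition total_cost C W xi : R := C xi + \sum_j xi 0 j * W 0 j.

Definition value C W : R := setmin [set total_cost C W xi | xi in simplex].

Definition minimizers C W : set 'rV[R]_n :=
  [set xi | simplex xi /\
     forall z, simplex z -> total_cost C W xi <= total_cost C W z].

Definition absolutely_causal (delta : R) C :=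
  forall W, orthant W -> forall xi, minimizers C W xi ->
  forall j, 0 < xi 0 j -> value C W > W 0 j + delta.

End Causality.

Arguments orthant {R} n.
Arguments simplex {R} n.

(* The row space of kermx (const_mx 1) is the set of u whose entries sum to 0,
   and the row space of B^T is the span of the columns of B. *)
Definition orthonormal_basis_of_ones_perp (R : realType) (n : nat)
    (B : 'M[R]_(n, n.-1)) :=
  B^T *m B = 1%:M /\ (B^T :=: kermx (const_mx 1 : 'cV[R]_n))%MS.

(* Main.v *)
(* Let x be a minimizer with x_j > 0 and v = e_j - x. The segment from x to e_j
   extends slightly beyond x inside the simplex, so the total cost along it has
   derivative 0 at x, and Taylor's formula bounds C(e_j) + W_j - V(W) by half
   the supremum of v H v^T along the segment. Since the entries of v sum to 0,
   v H v^T <= Lambda |v|^2, and |v|^2 <= 2 for a difference of two points of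
   the simplex.
   The bound by Lambda needs H symmetric (Schwarz's theorem), and the maximum
   of Lambda over the simplex has to exist: by compactness u B^T H B u^T attains
   its maximum over simplex points and unit vectors u, and the maximizing u is
   an eigenvector. *)
Require Import Defs.
From HB Require Import structures.
From mathcomp Require Import all_boot all_order all_algebra.
From mathcomp Require Import all_classical all_reals all_analysis.
From mathcomp Require Import ring lra.

Import Order.TTheory GRing.Theory Num.Theory.
Import numFieldNormedType.Exports.

Local Open Scope classical_set_scope.
Local Open Scope ring_scope.

(** * Directional derivatives of C^1 functions *)

Lemma cvg_is_derive (R : realType) (V : normedModType R) (F : V -> R)
    (x v : V) (l : R) :
  h^-1 *: (F (h *: v + x) - F x) @[h --> 0^'] --> l <-> is_derive x v F l.
Proof.
split=> [Fl|[Fx <-]]; last exact: Fx.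
by split; [apply/cvg_ex; exists l | exact: cvg_lim Fl].
Qed.

Lemma is_derive_line (R : realType) (V : normedModType R) (F : V -> R)
    (x v : V) (t l : R) :
  is_derive (x + t *: v) v F l -> is_derive t 1 (fun s => F (x + s *: v)) l.
Proof.
move=> /cvg_is_derive Fl; apply/cvg_is_derive.
rewrite [X in X @ _](_ : _ = fun h =>
  h^-1 *: (F (h *: v + (x + t *: v)) - F (x + t *: v))) //.
by apply/funext => h; rewrite [h *: 1]mulr1 scalerDl addrCA.
Qed.

(** The mean value theorem for F along the line through x. Both signs of [h] are covered, because
    the limits below are two-sided. *)
Lemma directional_MVT (R : realType) (V : normedModType R) (F dF : V -> R)
    (x v : V) (h : R) :
  (forall t, `|t| <= `|h| -> is_derive (x + t *: v) v F (dF (x + t *: v))) ->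
  exists2 t, `|t| <= `|h| & F (x + h *: v) - F x = h * dF (x + t *: v).
Proof.
move=> dF_; pose f s := F (x + s *: v).
have df (t : R) : `|t| <= `|h| -> is_derive t 1 f (dF (x + t *: v)).
  by move=> /dF_; exact: is_derive_line.
have fcont a b : (forall t, t \in `[a, b]%R -> `|t| <= `|h|) ->
    {within `[a, b], continuous f}.
  move=> sub; apply: derivable_within_continuous => t /sub /df.
  by move=> /@ex_derive.
case: (leP 0 h) => h0.
  have sub t : t \in `[0, h]%R -> `|t| <= `|h|.
    by rewrite in_itv/= => /andP[t0 th]; rewrite !ger0_norm.
  have df' t : t \in `]0, h[%R -> is_derive t 1 f (dF (x + t *: v)).
    by move=> ts; apply/df/sub/subset_itv_oo_cc.
  have [t ts] := MVT_segment h0 df' (fcont _ _ sub).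
  rewrite /f scale0r addr0 subr0 mulrC => Fh.
  by exists t; [exact: sub|].
have sub t : t \in `[h, 0]%R -> `|t| <= `|h|.
  by rewrite in_itv/= => /andP[t0 th]; rewrite !ler0_norm ?lerN2// ltW.
have df' t : t \in `]h, 0[%R -> is_derive t 1 f (dF (x + t *: v)).
  by move=> ts; apply/df/sub/subset_itv_oo_cc.
have [t ts] := MVT_segment (ltW h0) df' (fcont _ _ sub).
rewrite /f scale0r addr0 sub0r mulrN mulrC => Fh.
by exists t; [exact: sub|rewrite -opprB Fh opprK].
Qed.

(** The increment along u + w splits into a step along u from x and a step along w from x + hu. By
    the mean value theorem the second is h times [Dw] at a point close to x, and [Dw] is
    continuous. *)
Lemma is_derive_add_direction (R : realType) (V : normedModType R)
    (U : set V) (F Du Dw : V -> R) (u w : V) : open U ->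
  (forall x, U x -> is_derive x u F (Du x)) ->
  (forall x, U x -> is_derive x w F (Dw x)) ->
  (forall x, U x -> {for x, continuous Dw}) ->
  forall x, U x -> is_derive x (u + w) F (Du x + Dw x).
Proof.
move=> oU dFu dFw cDw x Ux; apply/cvg_is_derive.
have -> : (fun h => h^-1 *: (F (h *: (u + w) + x) - F x)) =
    (fun h => h^-1 *: (F (h *: u + x) - F x) +
              h^-1 *: (F (x + h *: u + h *: w) - F (x + h *: u))).
  apply/funext => h; rewrite -scalerDr; congr (_ *: _).
  rewrite scalerDr [h *: u + h *: w + x]addrC addrA [h *: u + x]addrC.
  by rewrite [RHS]addrC addrA subrK.
apply: cvgD; first exact/cvg_is_derive/dFu.
apply/cvgrPdist_lt => e e0.
have /nbhs_normP[r /= r0 xr] :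
    \forall y \near x, U y /\ `|Dw x - Dw y| < e.
  near=> y; split; near: y; first exact: open_nbhs_nbhs.
  by apply: cvgr_dist_lt e0; exact: cDw.
(* The summand 1 keeps the divisor positive when u = w = 0. *)
have uw0 : 0 < `|u| + `|w| + 1 by rewrite ltr_pwDr.
near=> h.
have hr : `|h| * (`|u| + `|w| + 1) < r.
  rewrite -ltr_pdivlMr//; near: h; apply: dnbhs0_lt; exact: divr_gt0.
have near_x t : `|t| <= `|h| -> `|x - (x + h *: u + t *: w)| < r.
  move=> th; apply: le_lt_trans hr.
  rewrite opprD opprD addrA addrA subrr sub0r -opprD normrN.
  rewrite (le_trans (ler_normD _ _))// !normrZ.
  have := ler_wpM2r (normr_ge0 w) th; have := normr_ge0 h; nra.
have [t th ->] : exists2 t, `|t| <= `|h| &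
    F (x + h *: u + h *: w) - F (x + h *: u) = h * Dw (x + h *: u + t *: w).
  by apply: directional_MVT => t th; apply: dFw; apply: (xr _ _).1; exact: near_x.
have h0 : h != 0 by near: h; exact: nbhs_dnbhs_neq.
rewrite [_ *: _]mulKf//; apply: (xr _ _).2; exact: near_x.
Unshelve. all: by end_near. Qed.

Lemma is_derive_scale_direction (R : realType) (V : normedModType R)
    (F : V -> R) (x v : V) (a l : R) :
  is_derive x v F l -> is_derive x (a *: v) F (a * l).
Proof.
(* The base point is written [a * 0] because the chain rule with t |-> a t takes the outer
   derivative at the image of 0. *)
move=> dF; have dline : is_derive (a * 0) 1 (fun s => F (x + s *: v)) l.
  by apply: is_derive_line; rewrite mulr0 scale0r addr0.
have /cvg_is_derive Fl : is_derive (0 : R) 1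
    ((fun s => F (x + s *: v)) \o (fun t => a * t)) (l * a).
  apply: is_derive1_comp.
  have := is_deriveZ a (is_derive_id (0 : R) 1).
  by rewrite [a *: 1]mulr1.
apply/cvg_is_derive; rewrite mulrC.
move: Fl; rewrite [X in X @ _](_ : _ = fun h =>
  h^-1 *: (F (h *: (a *: v) + x) - F x)) //; apply/funext => h /=.
by rewrite [h *: 1]mulr1 addr0 mulr0 scale0r addr0 scalerA [a * h]mulrC [x + _]addrC.
Qed.

(** Expand v in the standard basis and add the basis directions one at a time. *)
Lemma C1_is_derive (R : realType) (n : nat) (U : set 'rV[R]_n)
    (F : 'rV[R]_n -> R) : open U -> C1_on U F ->
  forall v x, U x -> is_derive x v F (\sum_i v 0 i * partial i F x).
Proof.
move=> oU [_ FU] v x Ux.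
suff /(_ (index_enum _) x Ux) : forall (s : seq 'I_n) x, U x -> is_derive x
    (\sum_(i <- s) v 0 i *: basis_vec i) F
    (\sum_(i <- s) v 0 i * partial i F x).
  by rewrite -row_sum_delta.
elim=> [|i s IHs] {Ux}x Ux.
  by rewrite !big_nil; exact: is_derive0.
(* The swap gives the head of the list the role of [w] in [is_derive_add_direction]: its derivative,
   a multiple of a partial, is continuous. *)
rewrite !big_cons addrC [X in is_derive _ _ _ X]addrC.
have [dF cF] := FU i.
apply: (is_derive_add_direction _ _ U F
  (fun y => \sum_(j <- s) v 0 j * partial j F y)
  (fun y => v 0 i * partial i F y)) => // y Uy.
- exact/is_derive_scale_direction/derivableP/dF.
- apply: continuousM; first exact: cst_continuous.
  exact: cF.
Qed.

(** * Symmetry of the Hessian *)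

Lemma is_derive_translate (R : realType) (V : normedModType R) (F : V -> R)
    (x a v : V) (l : R) :
  is_derive (x + a) v F l -> is_derive x v (fun y => F (y + a)) l.
Proof.
move=> /cvg_is_derive Fl; apply/cvg_is_derive.
rewrite [X in X @ _](_ : _ = fun h =>
  h^-1 *: (F (h *: v + (x + a)) - F (x + a))) //.
by apply/funext => h; rewrite addrA.
Qed.

(** Two mean value steps: along u for y |-> F(y + hw) - F(y), then along w for [Du]. The bound on
    [h] keeps every point in the ball of radius r. *)
Lemma second_difference (R : realType) (V : normedModType R) (F Du Dwu : V -> R)
    (x u w : V) (r h : R) :
  (forall y, `|x - y| < r -> is_derive y u F (Du y)) ->
  (forall y, `|x - y| < r -> is_derive y w Du (Dwu y)) ->
  `|h| * (`|u| + `|w| + 1) < r ->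
  exists2 y, `|x - y| < r &
    F (x + h *: u + h *: w) - F (x + h *: u) - (F (x + h *: w) - F x)
    = h * (h * Dwu y).
Proof.
move=> dF dDu hr.
have near_x s t : `|s| <= `|h| -> `|t| <= `|h| ->
    `|x - (x + s *: u + t *: w)| < r.
  move=> sh th; apply: le_lt_trans hr.
  rewrite opprD opprD addrA addrA subrr sub0r -opprD normrN.
  rewrite (le_trans (ler_normD _ _))// !normrZ.
  have := ler_wpM2r (normr_ge0 w) th; have := ler_wpM2r (normr_ge0 u) sh.
  have := normr_ge0 h; lra.
have near_x0 s : `|s| <= `|h| -> `|x - (x + s *: u)| < r.
  by move=> sh; have := near_x s 0; rewrite scale0r addr0 normr0; exact.
have [s sh ->] := directional_MVT _ _ (fun y => F (y + h *: w) - F y)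
  (fun y => Du (y + h *: w) - Du y) x u h
  (fun s sh => is_deriveB (is_derive_translate _ _ _ _ _ _ _
     (dF _ (near_x s h sh (lexx _)))) (dF _ (near_x0 s sh))).
have [t th ->] := directional_MVT _ _ Du Dwu (x + s *: u) w h
  (fun t th => dDu _ (near_x s t sh th)).
by exists (x + s *: u + t *: w) => //; exact: near_x.
Qed.

(** The second difference is symmetric in u and w, so [Dwu] and [Duw] take a common value at two
    points y and z near x; continuity at x carries the equality over to x. *)
Lemma mixed_directional_derivatives_eq (R : realType) (V : normedModType R)
    (U : set V) (F Du Dw Duw Dwu : V -> R) (u w : V) : open U ->
  (forall x, U x -> is_derive x u F (Du x)) ->
  (forall x, U x -> is_derive x w F (Dw x)) ->
  (forall x, U x -> is_derive x u Dw (Duw x)) ->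
  (forall x, U x -> is_derive x w Du (Dwu x)) ->
  forall x, U x -> {for x, continuous Duw} -> {for x, continuous Dwu} ->
  Duw x = Dwu x.
Proof.
move=> oU dFu dFw dDw dDu x Ux cDuw cDwu.
apply/eqP; rewrite -subr_eq0 -normr_le0; apply/ler_addgt0Pr => e e0.
have e2 : 0 < e / 2 by rewrite divr_gt0.
have /nbhs_normP[r /= r0 xr] : \forall y \near x,
    [/\ U y, `|Duw x - Duw y| < e / 2 & `|Dwu x - Dwu y| < e / 2].
  near=> y; split; near: y; first exact: open_nbhs_nbhs.
    exact: cvgr_dist_lt e2.
  exact: cvgr_dist_lt e2.
have uw0 : 0 < `|u| + `|w| + 1 by rewrite ltr_pwDr.
(* This makes |h| (|u| + |w| + 1) equal to r/2. *)
pose h := r / 2 / (`|u| + `|w| + 1).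
have h0 : 0 < h by rewrite !divr_gt0.
have hr : `|h| * (`|u| + `|w| + 1) < r.
  by rewrite gtr0_norm// divfK ?gt_eqF// ltr_pdivrMr// ltr_pMr// ltr1n.
have [y xy Ey] := second_difference _ _ F Du Dwu x u w r h
  (fun y xy => dFu _ (let: And3 p _ _ := xr y xy in p))
  (fun y xy => dDu _ (let: And3 p _ _ := xr y xy in p)) hr.
have hr' : `|h| * (`|w| + `|u| + 1) < r by rewrite [`|w| + _]addrC.
have [z xz Ez] := second_difference _ _ F Dw Duw x w u r h
  (fun y xy => dFw _ (let: And3 p _ _ := xr y xy in p))
  (fun y xy => dDw _ (let: And3 p _ _ := xr y xy in p)) hr'.
have yz : Dwu y = Duw z.
  apply: (mulfI (lt0r_neq0 h0)); apply: (mulfI (lt0r_neq0 h0)).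
  by rewrite -Ey -Ez [x + h *: w + _]addrAC; ring.
have [_ _ y2] := xr y xy; have [_ z1 _] := xr z xz.
rewrite add0r (_ : Duw x - Dwu x = (Duw x - Duw z) - (Dwu x - Dwu y));
  last by rewrite yz; ring.
by rewrite (le_trans (ler_normB _ _))// (splitr e) lerD// ltW.
Unshelve. all: by end_near. Qed.

Lemma hessian_sym (R : realType) (n : nat) (U : set 'rV[R]_n)
    (F : 'rV[R]_n -> R) (x : 'rV[R]_n) : open U -> C2_on U F -> U x ->
  (hessian F x)^T = hessian F x.
Proof.
move=> oU [[_ dF] d2F] Ux; apply/matrixP => i j; rewrite !mxE.
apply: (mixed_directional_derivatives_eq _ _ U F (partial j F) (partial i F)
  _ _ (basis_vec j) (basis_vec i)) => // [y Uy|y Uy|y Uy|y Uy||].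
- by apply: derivableP; exact: (dF j).1.
- by apply: derivableP; exact: (dF i).1.
- by apply: derivableP; exact: ((d2F i).2 j).1.
- by apply: derivableP; exact: ((d2F j).2 i).1.
- exact: ((d2F i).2 j).2.
- exact: ((d2F j).2 i).2.
Qed.

(** * Attained extrema, and the Rayleigh quotient of a symmetric matrix *)

Lemma setmax_eq (R : realType) (A : set R) (m : R) :
  A m -> ubound A m -> setmax A = m.
Proof.
move=> Am um; apply: xget_unique => [|y [Ay uy]]; first by split.
by apply/le_anti; rewrite um//= uy.
Qed.

Lemma setmin_eq (R : realType) (A : set R) (m : R) :
  A m -> lbound A m -> setmin A = m.
Proof.
move=> Am lm; apply: xget_unique => [|y [Ay ly]]; first by split.
by apply/le_anti; rewrite lm// ly.
Qed.

Section RayleighQuotient.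
Context {R : realType} {m : nat}.
Implicit Types (M : 'M[R]_m) (u v : 'rV[R]_m).

Definition quad M u : R := (u *m M *m u^T) 0 0.
(** Euclidean length squared; the norm of the library on row vectors is the largest absolute
    entry. *)
Definition sqnorm u : R := (u *m u^T) 0 0.

Lemma sqnormE u : sqnorm u = \sum_i u 0 i ^+ 2.
Proof. by rewrite /sqnorm mxE; apply: eq_bigr => i _; rewrite mxE expr2. Qed.

Lemma sqnorm_ge0 u : 0 <= sqnorm u.
Proof. by rewrite sqnormE sumr_ge0// => i _; exact: sqr_ge0. Qed.

Lemma sqnorm_eq0 u : (sqnorm u == 0) = (u == 0).
Proof.
apply/eqP/eqP => [|->]; last by rewrite /sqnorm mul0mx mxE.
rewrite sqnormE => /psumr_eq0P u0; apply/rowP => i; rewrite mxE.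
by apply/eqP; rewrite -sqrf_eq0 u0// => j _; exact: sqr_ge0.
Qed.

Lemma sqnormZ a u : sqnorm (a *: u) = a ^+ 2 * sqnorm u.
Proof. by rewrite /sqnorm linearZ/= -scalemxAl -scalemxAr !mxE mulrA expr2. Qed.

Lemma quadZ a M u : quad M (a *: u) = a ^+ 2 * quad M u.
Proof.
by rewrite /quad linearZ/= -!scalemxAl -scalemxAr !mxE mulrA expr2.
Qed.

Lemma quadD M u v t : quad M (u + t *: v) = quad M u +
  t * ((v *m M *m u^T) 0 0 + (u *m M *m v^T) 0 0) + t ^+ 2 * quad M v.
Proof.
have trE : (u + t *: v)^T = u^T + t *: v^T by rewrite linearD linearZ.
rewrite /quad trE !(mulmxDl, mulmxDr) -!scalemxAl -!scalemxAr.
move: (u *m M *m u^T) (v *m M *m u^T) (u *m M *m v^T) (v *m M *m v^T).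
by move=> uu vu uv vv; rewrite !mxE; ring.
Qed.

Lemma quad_eigenvector M u a : u *m M = a *: u -> quad M u = a * sqnorm u.
Proof. by rewrite /quad /sqnorm => ->; rewrite -scalemxAl mxE. Qed.

(* The positive semidefinite form of P = a - M vanishes at v, hence is
   stationary there along w = v P; its derivative in that direction is
   2 |w|^2, so w = 0. *)
Lemma rayleigh_max_eigenvector M v a : M^T = M ->
  (forall u, quad M u <= a * sqnorm u) -> quad M v = a * sqnorm v ->
  v *m M = a *: v.
Proof.
move=> Msym Mle Mv; pose P := a%:M - M.
have qP u : quad P u = a * sqnorm u - quad M u.
  by rewrite /quad /sqnorm /P mulmxBr mul_mx_scalar mulmxBl -scalemxAl !mxE.
have Psym : P^T = P by rewrite /P linearB/= tr_scalar_mx Msym.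
pose w := v *m P.
have quad_line t : quad P (v + t *: w) = 2 * t * sqnorm w + t ^+ 2 * quad P w.
  have wPv : (w *m P *m v^T) 0 0 = sqnorm w.
    by rewrite /sqnorm /w !trmx_mul Psym !mulmxA.
  have vPv : (v *m P *m v^T) 0 0 = 0 by rewrite -/(quad P v) qP Mv subrr.
  have vPw : (v *m P *m w^T) 0 0 = sqnorm w by [].
  by rewrite quadD wPv vPw /quad vPv; ring.
have q0 u : 0 <= quad P u by rewrite qP subr_ge0.
have w0 : sqnorm w = 0.
  have k0 : 0 < quad P w + 1 by rewrite ltr_wpDl.
  (* At this t the form equals -t^2 (quad P w + 2), so its nonnegativity forces t = 0. The summand 1
     keeps the denominator positive when [quad P w] vanishes. *)
  pose t := - sqnorm w / (quad P w + 1).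
  have Nt : sqnorm w = - t * (quad P w + 1).
    by rewrite /t !mulNr opprK divfK// gt_eqF.
  have := q0 (v + t *: w); rewrite quad_line {1}Nt => tle.
  have t0 : t = 0.
    apply/eqP; rewrite -sqrf_eq0 eq_le sqr_ge0 andbT.
    have := q0 w; have := sqr_ge0 t; nra.
  by rewrite Nt t0 oppr0 mul0r.
move/eqP: w0; rewrite sqnorm_eq0 /w /P mulmxBr mul_mx_scalar subr_eq0.
by move=> /eqP.
Qed.

(** A maximizer of the Rayleigh quotient is an eigenvector for a, and testing the bound on an
    eigenvector for b gives b <= a. *)
Lemma max_eigenvalue_eq M v a : M^T = M ->
  (forall u, quad M u <= a * sqnorm u) -> quad M v = a * sqnorm v ->
  v != 0 -> max_eigenvalue M = a.
Proof.
move=> Msym Mle Mv v0; apply: setmax_eq.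
  by apply/eigenvalueP; exists v => //; exact: rayleigh_max_eigenvector.
move=> b /= /eigenvalueP[u uM u0]; have := Mle u; rewrite (quad_eigenvector _ _ _ uM).
by rewrite ler_pM2r// lt_neqAle sqnorm_ge0 andbT eq_sym sqnorm_eq0.
Qed.

End RayleighQuotient.

(** * Compactness, and the maximum of the largest eigenvalue over a compact set *)

Lemma continuous_sum (R : realType) (T : topologicalType) (I : Type)
    (s : seq I) (f : I -> T -> R) (x : T) :
  (forall i, {for x, continuous (f i)}) ->
  {for x, continuous (fun y => \sum_(i <- s) f i y)}.
Proof.
move=> cf; elim: s => [|i s IHs].
  rewrite (_ : (fun _ => _) = cst 0); first exact: cst_continuous.
  by apply/funext => y; rewrite big_nil.
rewrite (_ : (fun _ => _) = f i + fun y => \sum_(j <- s) f j y).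
  exact: continuousD.
by apply/funext => y; rewrite big_cons.
Qed.

Lemma closed_unit_cube_compact (R : realType) (n : nat) (A : set 'rV[R]_n) :
  closed A -> (forall v, A v -> forall i, `|v 0 i| <= 1) -> compact A.
Proof.
move=> cA A1.
have cube := @rV_compact R n (fun=> `[-1, 1]%classic)
  (fun=> @segment_compact R (-1) 1).
apply: (subclosed_compact cA cube) => v Av i /=.
by rewrite in_itv/= -ler_norml A1.
Qed.

Lemma compact_simplex (R : realType) (n : nat) : compact (simplex n : set 'rV[R]_n).
Proof.
apply: closed_unit_cube_compact => [|v [v1 v0] i]; last first.
  rewrite ger0_norm// -v1 (bigD1 i)//= lerDl sumr_ge0// => j _; exact: v0.
rewrite (_ : simplex n = (fun v : 'rV[R]_n => \sum_j v 0 j) @^-1` [set 1] `&`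
    \bigcap_(j in setT) ((fun v : 'rV[R]_n => v 0 j) @^-1` [set x | 0 <= x])).
  apply: closedI.
    apply: preimage_closed; last exact: closed_eq.
    by move=> v _; apply: continuous_sum => j; exact: coord_continuous.
  apply: closed_bigI => j _; apply: preimage_closed; last exact: closed_ge.
  by move=> v _; exact: coord_continuous.
apply/seteqP; split => v [v1 v0]; split=> //; first by move=> j _; exact: v0.
by move=> j; exact: v0.
Qed.

Lemma compact_sphere (R : realType) (n : nat) :
  compact [set v : 'rV[R]_n | sqnorm v = 1].
Proof.
apply: closed_unit_cube_compact => [|v /= v1 i]; last first.
  rewrite -(@ler_pXn2r _ 2)// ?nnegrE// expr1n real_normK ?num_real//.
  rewrite -v1 sqnormE (bigD1 i)//= lerDl sumr_ge0// => j _; exact: sqr_ge0.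
apply: (@preimage_closed _ _ sqnorm [set 1]); last exact: closed_eq.
move=> v _; rewrite (_ : sqnorm = fun v => \sum_i v 0 i ^+ 2).
  apply: continuous_sum => i; apply: continuousM; exact: coord_continuous.
by apply/funext => u; rewrite sqnormE.
Qed.

Lemma quadE (R : realType) (m : nat) (M : 'M[R]_m) (u : 'rV[R]_m) :
  quad M u = \sum_i (\sum_j u 0 j * M j i) * u 0 i.
Proof. by rewrite /quad mxE; apply: eq_bigr => i _; rewrite !mxE. Qed.

(** The extreme value theorem on the product of K and the unit sphere, nonempty as 0 < m;
    homogeneity of degree 2 extends the bound from unit vectors to all u. *)
Lemma rayleigh_family_max (R : realType) (n m : nat) (K : set 'rV[R]_n)
    (M : 'rV[R]_n -> 'M[R]_m) : (0 < m)%N -> K !=set0 -> compact K ->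
  (forall x, K x -> forall i j, {for x, continuous (fun y => M y i j)}) ->
  exists x v, [/\ K x, sqnorm v = 1 &
    forall y u, K y -> quad (M y) u <= quad (M x) v * sqnorm u].
Proof.
move=> m0 [x0 Kx0] cK cM.
pose S := [set v : 'rV[R]_m | sqnorm v = 1].
have S0 : S !=set0.
  exists (delta_mx 0 (Ordinal m0)); rewrite /S /= sqnormE (bigD1 (Ordinal m0))//=.
  rewrite mxE !eqxx expr1n big1 ?addr0// => i /negPf im.
  by rewrite mxE im andbF expr0n.
have [] := @compact_EVT_max _ R (fun p => quad (M p.1) p.2) (K `*` S).
- by case: S0 => v0 Sv0; exists (x0, v0).
- exact: compact_setX cK (@compact_sphere R m).
- apply: continuous_in_subspaceT => -[x v] /set_mem[/= Kx _].
  rewrite (_ : (fun _ => _) = fun p : 'rV[R]_n * 'rV[R]_m =>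
    \sum_i (\sum_j p.2 0 j * M p.1 j i) * p.2 0 i); last first.
    by apply/funext => p; rewrite quadE.
  have c2 i : {for (x, v), continuous
      (fun p : 'rV[R]_n * 'rV[R]_m => p.2 0 i)}.
    apply: (@continuous_comp _ _ _ snd (fun u : 'rV[R]_m => u 0 i)).
      exact: cvg_snd.
    exact: coord_continuous.
  have c1 i j : {for (x, v), continuous
      (fun p : 'rV[R]_n * 'rV[R]_m => M p.1 i j)}.
    apply: (@continuous_comp _ _ _ fst (fun y => M y i j)).
      exact: cvg_fst.
    exact: cM.
  apply: continuous_sum => i; apply: continuousM => //.
  by apply: continuous_sum => j; apply: continuousM.
move=> [x v] /set_mem[/= Kx Sv] xvmax; exists x, v; split=> // y u Ky.
have [->|u0] := eqVneq u 0.
  by rewrite /quad /sqnorm !mul0mx mxE mulr0.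
have su0 : 0 < sqnorm u by rewrite lt_neqAle sqnorm_ge0 andbT eq_sym sqnorm_eq0.
pose a := Num.sqrt (sqnorm u).
have a2 : a ^+ 2 = sqnorm u by rewrite sqr_sqrtr// ltW.
have a0 : a != 0 by rewrite gt_eqF// sqrtr_gt0.
have Su : S (a^-1 *: u) by rewrite /S /= sqnormZ exprVn a2 mulVf// gt_eqF.
have := xvmax (y, a^-1 *: u) (mem_set (conj Ky Su)).
by rewrite /= quadZ exprVn a2 mulrC ler_pdivrMr.
Qed.

(** The joint maximum over points of K and unit vectors is the greatest of the largest eigenvalues,
    so [setmax] is a true maximum here and not its default 0. *)
Lemma quad_le_setmax_max_eigenvalue (R : realType) (n m : nat)
    (K : set 'rV[R]_n) (M : 'rV[R]_n -> 'M[R]_m) :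
  (0 < m)%N -> compact K ->
  (forall x, K x -> forall i j, {for x, continuous (fun y => M y i j)}) ->
  (forall x, K x -> (M x)^T = M x) ->
  forall x u, K x ->
  quad (M x) u <= setmax [set max_eigenvalue (M y) | y in K] * sqnorm u.
Proof.
move=> m0 cK cM Msym x u Kx.
have sphere_neq0 (v : 'rV[R]_m) : sqnorm v = 1 -> v != 0.
  by move=> v1; rewrite -sqnorm_eq0 v1 oner_eq0.
have [z [v [Kz v1 zmax]]] := rayleigh_family_max _ _ _ K M m0
  (ex_intro _ x Kx) cK cM.
rewrite (@setmax_eq _ _ (quad (M z) v)); first exact: zmax.
  exists z => //; apply: (max_eigenvalue_eq _ v) => //; last exact: sphere_neq0.
  - exact: Msym.
  - by move=> w; exact: zmax.
  - by rewrite v1 mulr1.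
move=> _ [y Ky <-].
(* Over the singleton {y} the same maximization yields a w with [max_eigenvalue (M y)] equal to
   [quad (M y) w], which the joint maximum dominates. *)
have [_ [w [-> w1 ymax]]] := rayleigh_family_max _ _ _ [set y] M m0
  (ex_intro _ y erefl) (@compact_set1 _ y)
  (fun y' e => cM y' (eq_ind_r K Ky e)).
rewrite (max_eigenvalue_eq _ w (quad (M y) w)).
- by have := zmax y w Ky; rewrite w1 mulr1.
- exact: Msym.
- by move=> w'; exact: ymax.
- by rewrite w1 mulr1.
- exact: sphere_neq0.
Qed.

(** * A one-sided Taylor bound of order two *)

(** The mean value theorem for f(t) - (K/2) t^2 gives a point c with f(1) - f(0) - K/2 = df(c) - K
    c, and a second use, for [df] on [0, c], gives df(c) - df(0) <= K c. *)
Lemma taylor2_le (R : realType) (f df d2f : R -> R) (K : R) :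
  (forall t : R, 0 <= t <= 1 -> is_derive t 1 f (df t)) ->
  (forall t : R, 0 <= t <= 1 -> is_derive t 1 df (d2f t)) ->
  (forall t : R, 0 <= t <= 1 -> d2f t <= K) ->
  f 1 - f 0 - df 0 <= K / 2.
Proof.
move=> f1 f2 f2K.
pose g (t : R) := f t - K / 2 * (t * t).
have g1 (t : R) : 0 <= t <= 1 -> is_derive t 1 g (df t - K * t).
  move=> t01.
  have tx : is_derive t 1 ((K / 2) \*: ((id : R -> R) * id)) (K * t).
    apply: (is_derive_eq (is_deriveZ _ (is_deriveM _ _))).
    by rewrite /= ![_ *: 1]mulr1 [LHS]mulrDr -mulrDl -splitr.
  exact: is_deriveB (f1 t t01) tx.
have itv01 (t a b : R) : 0 <= a -> b <= 1 -> t \in `[a, b]%R -> 0 <= t <= 1.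
  by rewrite in_itv/= => a0 b1 /andP[at_ tb]; rewrite (le_trans a0)//= (le_trans tb).
have [c c01] : exists2 c, c \in `[0, 1]%R & g 1 - g 0 = (df c - K * c) * (1 - 0).
  apply: MVT_segment => // [t /subset_itv_oo_cc ts|].
    exact/g1/(itv01 t 0 1).
  apply: derivable_within_continuous => t ts.
  exact: (@ex_derive _ _ _ _ _ _ _ (g1 t (itv01 t 0 1 (lexx _) (lexx _) ts))).
have /andP[c0 c1] := itv01 c 0 1 (lexx _) (lexx _) c01.
have [d d0c] : exists2 d, d \in `[0, c]%R & df c - df 0 = d2f d * (c - 0).
  apply: MVT_segment => // [t /subset_itv_oo_cc ts|].
    exact/f2/(itv01 t 0 c).
  apply: derivable_within_continuous => t ts.
  exact: (@ex_derive _ _ _ _ _ _ _ (f2 t (itv01 t 0 c (lexx _) c1 ts))).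
have := f2K d (itv01 d 0 c (lexx _) c1 d0c).
rewrite /g !mulr0 !subr0 !mulr1 => dK.
have := ler_wpM2r c0 dK; lra.
Qed.

(** * Finite minima and the geometry of the simplex *)

(** The index [i] makes [I] nonempty, so the minimum is attained. *)
Lemma setmin_range_le (R : realType) (I : finType) (f : I -> R) (i : I) :
  setmin (range f) <= f i.
Proof.
case: (arg_minP f (isT : xpredT i)) => k _ kmin.
rewrite (@setmin_eq _ _ (f k)); [exact: kmin|by exists k|].
by move=> _ [l _ <-]; exact: kmin.
Qed.

Lemma simplex_coord_le1 (R : realType) (n : nat) (x : 'rV[R]_n) i :
  simplex n x -> x 0 i <= 1.
Proof.
by move=> [<- x0]; rewrite (bigD1 i)//= lerDl sumr_ge0// => j _; exact: x0.
Qed.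

(** For entries a, b in [0, 1], (a - b)^2 <= a + b; each point contributes total mass 1. *)
Lemma sqnorm_sub_simplex (R : realType) (n : nat) (x y : 'rV[R]_n) :
  simplex n x -> simplex n y -> sqnorm (y - x) <= 2.
Proof.
move=> sx sy; rewrite sqnormE.
apply: (@le_trans _ _ (\sum_i (y 0 i + x 0 i))); last first.
  by rewrite big_split/= sx.1 sy.1.
apply: ler_sum => i _; rewrite !mxE.
have := sx.2 i; have := sy.2 i.
have := simplex_coord_le1 _ _ _ i sx; have := simplex_coord_le1 _ _ _ i sy.
nra.
Qed.

Lemma simplex_basis_vec (R : realType) (n : nat) (j : 'I_n) :
  simplex n (basis_vec j : 'rV[R]_n).
Proof.
split=> [|k]; last by rewrite mxE; case: (_ && _).
rewrite (bigD1 j)//= mxE !eqxx big1 ?addr0// => k /negPf kj.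
by rewrite mxE kj andbF.
Qed.

(** Entry j becomes x_j + t (1 - x_j), at least x_j^2 when t >= -x_j; every other entry becomes (1 -
    t) x_k. Negative t are thus allowed as soon as x_j > 0. *)
Lemma simplex_line (R : realType) (n : nat) (x : 'rV[R]_n) (j : 'I_n) (t : R) :
  simplex n x -> - x 0 j <= t -> t <= 1 ->
  simplex n (x + t *: (basis_vec j - x)).
Proof.
move=> sx t0 t1; have [x1 x0] := sx; split=> [|k].
  under eq_bigr do rewrite !mxE.
  rewrite big_split/= -mulr_sumr sumrB x1.
  have [] := simplex_basis_vec R n j => + _.
  under eq_bigr do rewrite mxE.
  by move=> ->; rewrite subrr mulr0 addr0.
rewrite !mxE eqxx/=; have [->|kj] := eqVneq k j.
  by have := x0 j; have := simplex_coord_le1 _ _ _ j sx; rewrite mulr1n; nra.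
by have := x0 k; rewrite mulr0n; nra.
Qed.

Lemma simplex_sub_orthant (R : realType) (n : nat) :
  simplex n `<=` (orthant n `\ 0 : set 'rV[R]_n).
Proof.
move=> x [x1 x0]; split=> // /= xE; move: x1.
rewrite xE big1 => [/eqP|i _]; last by rewrite mxE.
by rewrite eq_sym oner_eq0.
Qed.

(** * The Hessian as a quadratic form and its projection *)

(** A vector of zero sum lies in the row space of B^T, so v = u B^T, and B^T B = 1 makes u |-> u B^T
    an isometry. *)
Lemma ones_perp_coordinates (R : realType) (n : nat) (B : 'M[R]_(n, n.-1))
    (v : 'rV[R]_n) : orthonormal_basis_of_ones_perp B -> \sum_i v 0 i = 0 ->
  exists2 u, sqnorm u = sqnorm v &
    forall M, quad (B^T *m M *m B) u = quad M v.
Proof.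
move=> [BB Bspan] v0.
have /submxP[u ->] : (v <= B^T)%MS.
  rewrite Bspan; apply/sub_kermxP/rowP => k; rewrite [LHS]mxE [RHS]mxE -[RHS]v0.
  by apply: eq_bigr => i _; rewrite mxE mulr1.
exists u => [|M]; last by rewrite /quad trmx_mul trmxK !mulmxA.
by rewrite /sqnorm trmx_mul trmxK mulmxA -[u *m B^T *m B]mulmxA BB mulmx1.
Qed.

Lemma quad_hessian_is_derive (R : realType) (n : nat) (U : set 'rV[R]_n)
    (F : 'rV[R]_n -> R) (x v : 'rV[R]_n) : open U -> C2_on U F -> U x ->
  is_derive x v (fun y => \sum_i v 0 i * partial i F y) (quad (hessian F x) v).
Proof.
move=> oU [_ d2F] Ux.
rewrite (_ : (fun _ => _) = \sum_i (v 0 i \*: partial i F)); last first.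
  by apply/funext => y; rewrite fct_sumE.
rewrite quadE (eq_bigr (fun i =>
  v 0 i *: \sum_j v 0 j * partial j (partial i F) x)); last first.
  move=> i _; rewrite [RHS]mulrC; congr (_ * _).
  by apply: eq_bigr => j _; rewrite mxE.
apply: is_derive_sum => i; apply: is_deriveZ.
exact: (C1_is_derive _ _ U).
Qed.

Lemma continuous_projected_hessian (R : realType) (n m : nat)
    (U : set 'rV[R]_n) (F : 'rV[R]_n -> R) (A : 'M[R]_(m, n)) (B : 'M[R]_(n, m))
    (x : 'rV[R]_n) i j : C2_on U F -> U x ->
  {for x, continuous (fun y => (A *m hessian F y *m B) i j)}.
Proof.
move=> [_ d2F] Ux.
rewrite (_ : (fun _ => _) = fun y => \sum_l
  (\sum_k A i k * partial k (partial l F) y) * B l j); last first.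
  apply/funext => y; rewrite mxE; apply: eq_bigr => l _; rewrite mxE.
  by congr (_ * _); apply: eq_bigr => k _; rewrite mxE.
apply: continuous_sum => l; apply: continuousM; last exact: cst_continuous.
apply: continuous_sum => k; apply: continuousM; first exact: cst_continuous.
exact: ((d2F l).2 k).2.
Qed.

(** * Comparison of a minimizer with the vertices of the simplex *)

Theorem theorem3p3 (R : realType) (n : nat) (hn : (2 <= n)%N)
    (delta : R) (hdelta : 0 <= delta)
    (C : 'rV[R]_n -> R) (H : 'rV[R]_n -> 'M[R]_n)
    (Cpos : forall xi, (orthant n `\ 0) xi -> 0 < C xi)
    (C2 : C2_with_hessian (orthant n `\ 0) C H)
    (B : 'M[R]_(n, n.-1)) (hB : orthonormal_basis_of_ones_perp B)
    (hC : delta + Num.max 0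
            (setmax [set max_eigenvalue (B^T *m H xi *m B) | xi in simplex n])
          < setmin (range (fun i : 'I_n => C (basis_vec i)))) :
  absolutely_causal delta C.
Proof.
have [U [F [oU DU C2F CH]]] := C2.
have sU x : simplex n x -> U x by move=> /simplex_sub_orthant /DU.
have CF x : simplex n x -> C x = F x by move=> /simplex_sub_orthant /CH[].
(* [H] is tied to the Hessian of [F] only on the punctured orthant, whereas [hessian F] is
   continuous on the open set [U]. *)
pose M x := B^T *m hessian F x *m B.
have ME : [set max_eigenvalue (B^T *m H x *m B) | x in simplex n] =
    [set max_eigenvalue (M x) | x in simplex n].
  by apply: eq_imagel => x /simplex_sub_orthant /CH[_ ->].
rewrite ME in hC; set L := setmax _ in hC.
have quad_le x u : simplex n x -> quad (M x) u <= L * sqnorm u.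
  apply: quad_le_setmax_max_eigenvalue.
  (* Here n >= 2 is used: the projected Hessian has positive size n - 1. *)
  - by rewrite -subn1 subn_gt0.
  - exact: compact_simplex.
  - by move=> y sy i j; apply: (continuous_projected_hessian _ _ _ U) => //; exact: sU.
  - by move=> y sy; rewrite /M !trmx_mul trmxK (hessian_sym _ _ U) ?mulmxA//; exact: sU.
move=> W _ x [sx xmin] j xj0.
have -> : value C W = total_cost C W x.
  by apply: setmin_eq; [exists x|move=> _ [y sy <-]; exact: xmin].
have Cj : delta + Num.max 0 L < C (basis_vec j).
  exact: lt_le_trans hC (setmin_range_le _ _ (fun i => C (basis_vec i)) j).
pose v := basis_vec j - x; pose w := \sum_k v 0 k * W 0 k.
pose D y := \sum_i v 0 i * partial i F y.
(* The total cost along the line through x and e_j, up to the constant x^T W. *)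
pose f (t : R) := F (x + t *: v) + t * w.
have f1 t : simplex n (x + t *: v) -> is_derive t 1 f (D (x + t *: v) + w).
  move=> st; apply: is_deriveD.
    by apply/is_derive_line/(C1_is_derive _ _ U) => //; [case: C2F|exact: sU].
  have := is_deriveZ w (is_derive_id t 1).
  by rewrite [w *: 1]mulr1 (_ : w \*: id = fun t => t * w)//;
     apply/funext => s; rewrite /= mulrC.
have f2 t : simplex n (x + t *: v) ->
    is_derive t 1 (fun t => D (x + t *: v) + w) (quad (hessian F (x + t *: v)) v).
  move=> st; rewrite -[quad _ _]addr0; apply: is_deriveD.
  by apply/is_derive_line/(quad_hessian_is_derive _ _ U) => //; exact: sU.
have costE t : simplex n (x + t *: v) ->
    total_cost C W (x + t *: v) = f t + \sum_k x 0 k * W 0 k.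
  move=> st; rewrite /total_cost CF// /f -addrA; congr (_ + _).
  rewrite addrC /w mulr_sumr -big_split/=; apply: eq_bigr => k _.
  by rewrite !mxE; ring.
(* Since x_j > 0, the parameter 0 is interior to ]-x_j, 1[, so the minimum there is stationary. *)
have f0min : is_derive (0 : R) 1 f 0.
  have line (t : R) : t \in `](- x 0 j), 1[%R -> simplex n (x + t *: v).
    by rewrite in_itv/= => /andP[/ltW t0 /ltW t1]; exact: simplex_line.
  apply: (@derive1_at_min _ f (- x 0 j) 1).
  - by rewrite (le_trans _ ler01)// oppr_le0 ltW.
  - by move=> t /line /f1 /@ex_derive.
  - by rewrite in_itv/= oppr_lt0 xj0 ltr01.
  - move=> t /line st; have s0 : simplex n (x + 0 *: v).
      by rewrite scale0r addr0.
    by have := xmin _ st; rewrite -{1}[x]addr0 -(scale0r v) !costE// lerD2r.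
have Dx : D x + w = 0.
  have := f1 0; rewrite scale0r addr0 => /(_ sx) /@derive_val <-.
  exact: (@derive_val _ _ _ _ _ _ _ f0min).
have line (t : R) : 0 <= t <= 1 -> simplex n (x + t *: v).
  by move=> /andP[t0 t1]; apply: simplex_line => //; lra.
have sj := simplex_basis_vec R n j.
have v_sum : \sum_i v 0 i = 0.
  under eq_bigr do rewrite !mxE.
  rewrite sumrB sx.1; have [] := sj => + _.
  by under eq_bigr do rewrite mxE; move=> ->; rewrite subrr.
have [u uv quB] := ones_perp_coordinates _ _ _ v hB v_sum.
(* Replacing |u|^2 by its bound 2 requires a nonnegative factor, whence the maximum of 0 and L. *)
have f2_le (t : R) : 0 <= t <= 1 -> quad (hessian F (x + t *: v)) v <= Num.max 0 L * 2.
  move=> /line st; rewrite -quB (le_trans (quad_le _ _ st))//.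
  apply: (@le_trans _ _ (Num.max 0 L * sqnorm u)).
    by rewrite ler_wpM2r ?sqnorm_ge0// le_max lexx orbT.
  by rewrite ler_wpM2l ?le_max ?lexx// uv sqnorm_sub_simplex.
(* The 2 cancels the 1/2 in Taylor's bound: C(e_j) + W_j - V(W) <= max(0, L) < C(e_j) - delta. *)
have := taylor2_le _ f _ _ _ (fun t t01 => f1 t (line t t01))
  (fun t t01 => f2 t (line t t01)) f2_le.
rewrite scale0r addr0 Dx subr0 mulfK ?pnatr_eq0//.
have xv : x + 1 *: v = basis_vec j by rewrite scale1r addrC subrK.
have := costE 0; rewrite scale0r addr0 => /(_ sx) ->.
have := costE 1; rewrite xv => /(_ sj).
rewrite /total_cost (_ : \sum_k basis_vec j 0 k * W 0 k = W 0 j).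
  by move: Cj; lra.
rewrite (bigD1 j)//= big1 ?addr0 => [|k /negPf kj]; first by rewrite mxE !eqxx mul1r.
by rewrite mxE kj andbF mul0r.
Qed.
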